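(* For every natural number $n\ge 0$, let $\mathcal{O}_n$ be the monoid presented by the generators $p^i,q^i$ ($0\le i\le n-2$; no generators if $n<2$), with unit $\mathbf{1}$ and multiplication $\circ$, subject to the monoid equations and the following equations, each imposed for all indices for which every generator occurring in it is defined: \begin{itemize} \item $p^i\circ p^j=p^j\circ p^i$ for $j+1<i$; $\quad p^i\circ p^i=p^i$; $\quad p^i\circ p^{i+1}\circ p^i=p^{i+1}\circ p^i\circ p^{i+1}=p^i\circ p^{i+1}$; \item $q^i\circ q^j=q^j\circ q^i$ for $j+1<i$; $\quad q^i\circ q^i=q^i$; $\quad q^i\circ q^{i+1}\circ q^i=q^{i+1}\circ q^i\circ q^{i+1}=q^{i+1}\circ q^i$; \item $p^i\circ q^j=q^j\circ p^i$ for $j<i$ or $i+1<j$; \item $p^i\circ q^i=p^i$; $\quad p^i\circ q^{i+1}=q^{i+1}$; \item $q^i\circ p^i=q^i$; $\quad q^{i+1}\circ p^i=p^i$. \end{itemize} Then the assignment $p^i\mapsto\sigma(p^i)$, $q^i\mapsto\sigma(q^i)$ extends to an isomorphism $\sigma$ from $\mathcal{O}_n$ onto the monoid of all endomorphisms of the object $n$ of the simplicial category $\Delta$, i.e. the monoid (under composition) of all order-preserving functions $\{0,\ldots,n-1\}\to\{0,\ldots,n-1\}$.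
   Context: The simplicial category $\Delta$ has as objects all finite ordinals $n=\{0,\ldots,n-1\}$ (including $0$) and as arrows all order-preserving functions ($i\le j$ implies $\varphi(i)\le\varphi(j)$). The composition $f\circ g$ means first $g$, then $f$. For $0\le i\le n-2$, $\sigma(p^i):n\to n$ is the function with $\sigma(p^i)(i+1)=i$ and $\sigma(p^i)(j)=j$ for $j\ne i+1$; $\sigma(q^i):n\to n$ is the function with $\sigma(q^i)(i)=i+1$ and $\sigma(q^i)(j)=j$ for $j\neq i$. The map $\sigma$ sends $\mathbf{1}$ to the identity function and satisfies $\sigma(x\circ y)=\sigma(x)\circ\sigma(y)$. *)

(* Defs.v *)
From HB Require Import structures.
From mathcomp Require Import all_boot generic_quotient boolp.

Set Implicit Arguments.
Unset Strict Implicit.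
Unset Printing Implicit Defensive.

Declare Scope mterm_scope.
Delimit Scope mterm_scope with mterm.

(* Monoid presented by a type G of generators and a set R of equations between
   formal monoid terms: the quotient of all terms by the least congruence that
   contains R and the monoid equations. *)
Section Presentation.
Variable G : Type.

Inductive mterm : Type :=
  | MGen of G
  | MOne
  | MMul of mterm & mterm.

Variable R : mterm -> mterm -> Prop.

Inductive meq : mterm -> mterm -> Prop :=
  | meq_refl u : meq u u
  | meq_sym u v : meq u v -> meq v u
  | meq_trans v u w : meq u v -> meq v w -> meq u w
  | meq_mul u u' v v' : meq u u' -> meq v v' -> meq (MMul u v) (MMul u' v')
  | meq_mulA u v w : meq (MMul u (MMul v w)) (MMul (MMul u v) w)
  | meq_mul1l u : meq (MMul MOne u) u
  | meq_mul1r u : meq (MMul u MOne) u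
  | meq_rel u v : R u v -> meq u v.

HB.instance Definition _ := gen_eqMixin mterm.
HB.instance Definition _ := gen_choiceMixin mterm.

Definition meqb : rel mterm := fun u v => `[< meq u v >].

Fact meqb_refl : reflexive meqb.
Proof. by move=> u; apply/asboolP; apply: meq_refl. Qed.

Fact meqb_sym : symmetric meqb.
Proof. by move=> u v; apply/asboolP/asboolP; apply: meq_sym. Qed.

Fact meqb_trans : transitive meqb.
Proof.
by move=> v u w /asboolP uv /asboolP vw; apply/asboolP; apply: meq_trans vw.
Qed.

Canonical meqb_equiv := EquivRel meqb meqb_refl meqb_sym meqb_trans.

Definition presented : Type := {eq_quot meqb}%qT.
HB.instance Definition _ := Choice.on presented.
HB.instance Definition _ := EqQuotient.on presented.

Definition pclass (u : mterm) : presented := (\pi_presented u)%qT.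

Lemma pclassP u v : reflect (meq u v) (pclass u == pclass v).
Proof. by rewrite /pclass piE; apply: asboolP. Qed.

Lemma pclass_repr (x : presented) : pclass (repr x) = x.
Proof. exact: reprK. Qed.

Lemma repr_pclass u : meq (repr (pclass u)) u.
Proof. by apply/pclassP; rewrite pclass_repr. Qed.

Definition pone : presented := pclass MOne.
Definition pmul (x y : presented) : presented :=
  pclass (MMul (repr x) (repr y)).

Lemma pclassM u v : pclass (MMul u v) = pmul (pclass u) (pclass v).
Proof.
by apply/eqP/pclassP; apply: meq_mul; apply: meq_sym; apply: repr_pclass.
Qed.

Fact pmulA : associative pmul.
Proof.
move=> x y z; rewrite -[x]pclass_repr -[y]pclass_repr -[z]pclass_repr.
by rewrite -!pclassM; apply/eqP/pclassP; apply: meq_mulA.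
Qed.

Fact pmul1g : left_id pone pmul.
Proof.
move=> x; rewrite -[x]pclass_repr -pclassM.
by apply/eqP/pclassP; apply: meq_mul1l.
Qed.

Fact pmulg1 : right_id pone pmul.
Proof.
move=> x; rewrite -[x]pclass_repr -pclassM.
by apply/eqP/pclassP; apply: meq_mul1r.
Qed.

HB.instance Definition _ := isMonoid.Build presented pmulA pmul1g pmulg1.

End Presentation.

Arguments MOne {G}.
Infix "∘" := MMul (at level 40, left associativity) : mterm_scope.

(* 'I_n.-1 is the index range 0 <= i <= n - 2, and is empty when n < 2. *)
Inductive Ogen (n : nat) : Type :=
  | Pgen of 'I_n.-1
  | Qgen of 'I_n.-1.

Section Orel.
Variable n : nat.
Local Notation p i := (MGen (Pgen i)).
Local Notation q i := (MGen (Qgen i)).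
Local Open Scope mterm_scope.

Inductive Orel : mterm (Ogen n) -> mterm (Ogen n) -> Prop :=
  | Orel_pC (i j : 'I_n.-1) : j.+1 < i -> Orel (p i ∘ p j) (p j ∘ p i)
  | Orel_pp (i : 'I_n.-1) : Orel (p i ∘ p i) (p i)
  | Orel_ppp1 (i j : 'I_n.-1) : j = i.+1 :> nat ->
      Orel (p i ∘ p j ∘ p i) (p j ∘ p i ∘ p j)
  | Orel_ppp2 (i j : 'I_n.-1) : j = i.+1 :> nat ->
      Orel (p j ∘ p i ∘ p j) (p i ∘ p j)
  | Orel_qC (i j : 'I_n.-1) : j.+1 < i -> Orel (q i ∘ q j) (q j ∘ q i)
  | Orel_qq (i : 'I_n.-1) : Orel (q i ∘ q i) (q i)
  | Orel_qqq1 (i j : 'I_n.-1) : j = i.+1 :> nat ->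
      Orel (q i ∘ q j ∘ q i) (q j ∘ q i ∘ q j)
  | Orel_qqq2 (i j : 'I_n.-1) : j = i.+1 :> nat ->
      Orel (q j ∘ q i ∘ q j) (q j ∘ q i)
  | Orel_pqC (i j : 'I_n.-1) : (j < i) || (i.+1 < j) ->
      Orel (p i ∘ q j) (q j ∘ p i)
  | Orel_pq (i : 'I_n.-1) : Orel (p i ∘ q i) (p i)
  | Orel_pqS (i j : 'I_n.-1) : j = i.+1 :> nat -> Orel (p i ∘ q j) (q j)
  | Orel_qp (i : 'I_n.-1) : Orel (q i ∘ p i) (q i)
  | Orel_qSp (i j : 'I_n.-1) : j = i.+1 :> nat -> Orel (q j ∘ p i) (p i).

End Orel.

Definition Omonoid (n : nat) : monoidType := presented (@Orel n).
Definition Op (n : nat) (i : 'I_n.-1) : Omonoid n :=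
  pclass (@Orel n) (MGen (Pgen i)).
Definition Oq (n : nat) (i : 'I_n.-1) : Omonoid n :=
  pclass (@Orel n) (MGen (Qgen i)).

(* Arrows m -> n of the simplicial category, including m = 0 and n = 0. *)
Definition order_preserving (m n : nat) (f : {ffun 'I_m -> 'I_n}) : bool :=
  [forall i : 'I_m, forall j : 'I_m, (i <= j) ==> (f i <= f j)].

Record Delta (m n : nat) : Type := DeltaArrow {
  Delta_fun :> {ffun 'I_m -> 'I_n};
  Delta_homo : order_preserving Delta_fun
}.

HB.instance Definition _ m n := [isSub for @Delta_fun m n].
HB.instance Definition _ m n := [Finite of Delta m n by <:].

Lemma order_preservingP m n (f : {ffun 'I_m -> 'I_n}) :
  reflect {homo f : i j / (i <= j)%N} (order_preserving f).
Proof.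
apply: (iffP forallP) => [fH i j ij | fH i].
  by move/forallP: (fH i) => /(_ j) /implyP; apply.
by apply/forallP => j; apply/implyP; apply: fH.
Qed.

Fact Delta_id_homo n : order_preserving [ffun i : 'I_n => i].
Proof. by apply/order_preservingP => i j ij; rewrite !ffunE. Qed.
Definition Delta_id n : Delta n n := DeltaArrow (Delta_id_homo n).

Fact Delta_comp_homo l m n (f : Delta m n) (g : Delta l m) :
  order_preserving [ffun i => f (g i)].
Proof.
apply/order_preservingP => i j ij; rewrite !ffunE.
by apply: (order_preservingP _ (Delta_homo f));
   apply: (order_preservingP _ (Delta_homo g)).
Qed.
Definition Delta_comp l m n (f : Delta m n) (g : Delta l m) : Delta l n :=
  DeltaArrow (Delta_comp_homo f g).

Definition DeltaEnd (n : nat) : Type := Delta n n.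
HB.instance Definition _ n := Finite.on (DeltaEnd n).

Fact Delta_compA n : associative (@Delta_comp n n n).
Proof. by move=> f g h; apply/val_inj/ffunP => i; rewrite !ffunE. Qed.

Fact Delta_comp1f n : left_id (Delta_id n) (@Delta_comp n n n).
Proof. by move=> f; apply/val_inj/ffunP => i; rewrite !ffunE. Qed.

Fact Delta_compf1 n : right_id (Delta_id n) (@Delta_comp n n n).
Proof. by move=> f; apply/val_inj/ffunP => i; rewrite !ffunE. Qed.

HB.instance Definition _ n := isMonoid.Build (DeltaEnd n)
  (@Delta_compA n) (@Delta_comp1f n) (@Delta_compf1 n).

(* For i : 'I_n.-1, the elements i and i + 1 of 'I_n. *)
Definition ord_lo n (i : 'I_n.-1) : 'I_n := widen_ord (leq_pred n) i.

Fact ord_hi_subproof n (i : 'I_n.-1) : i.+1 < n.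
Proof. by case: n i => [|n] i; [case: i | rewrite ltnS ltn_ord]. Qed.
Definition ord_hi n (i : 'I_n.-1) : 'I_n := Ordinal (ord_hi_subproof i).

Definition sigma_p_fun n (i : 'I_n.-1) : {ffun 'I_n -> 'I_n} :=
  [ffun j => if j == ord_hi i then ord_lo i else j].
Definition sigma_q_fun n (i : 'I_n.-1) : {ffun 'I_n -> 'I_n} :=
  [ffun j => if j == ord_lo i then ord_hi i else j].

Fact sigma_p_homo n (i : 'I_n.-1) : order_preserving (sigma_p_fun i).
Proof.
apply/order_preservingP => j k jk; rewrite !ffunE -!val_eqE /=.
case: eqP => [ej|nj]; case: eqP => [ek|nk] //=; first by rewrite -ltnS -ej ltnW.
by move: jk; rewrite leq_eqVlt ek ltnS => /orP[/eqP|].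
Qed.

Fact sigma_q_homo n (i : 'I_n.-1) : order_preserving (sigma_q_fun i).
Proof.
apply/order_preservingP => j k jk; rewrite !ffunE -!val_eqE /=.
case: eqP => [ej|nj]; case: eqP => [ek|nk] //=.
  by rewrite ltn_neqAle -{2}ej jk andbT; apply/eqP=> e; apply: nk.
by rewrite -ek leqW.
Qed.

Definition sigma_p n (i : 'I_n.-1) : DeltaEnd n := DeltaArrow (sigma_p_homo i).
Definition sigma_q n (i : 'I_n.-1) : DeltaEnd n := DeltaArrow (sigma_q_homo i).

(* Main.v *)
Require Import Defs.
From HB Require Import structures.
From mathcomp Require Import all_boot zify.

Set Implicit Arguments.
Unset Strict Implicit.
Unset Printing Implicit Defensive.

Local Open Scope group_scope.

(** Put m = n - 1.  An order-preserving f factors as f = f+ o f-, with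
    f- x = min (f x) x and f+ x = max (f x) x, because f x <= x implies
    f (f x) <= f x.  This yields a normal form [nf]: the decreasing map f- is
    the product, for x from m down to 0, of the blocks
      [run p (f x) x] = p^(f x) o ... o p^(x - 1)
    (empty unless f x < x), and f+ is the product of the mirror-image blocks of
    the q's.  [nf_action] checks that this word evaluates to f, so evaluation is
    onto.

    Faithfulness is the statement that every word u equals the normal form of
    the function that it denotes.  By induction on u it is enough that
    multiplying [nf f] by a generator on the right gives the normal form of
    f o p^i or f o q^i ([nf_lower], [nf_raise]).  Right multiplication changes
    the value of f at one point only: p^i copies the value at i to i + 1, and
    q^i copies the value at i + 1 to i.  The rewriting is local, since a block
    is a zero element for the letters it contains ([run_mul_run],
    [run_mul_run_l]): a block left incomplete is swallowed by its neighbour.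

    The presentation is invariant under the reflection j |-> n - 1 - j of the
    finite ordinal, which exchanges p^i with q^(m - 1 - i).  So only the p-part
    of normal forms is studied, under both kinds of generators; reflecting
    gives the q-part. *)

(** * Reflection-symmetric half of the presentation *)

(** Only the p-p relations and the relations with p on the left of q are
    listed: the remaining ones are the same list for the reflected families
    [rev_gen m q] and [rev_gen m p].  Families are indexed by nat, with
    relations only below m, to keep index arithmetic out of ordinals. *)
Record zigzag_rels (M : monoidType) (m : nat) (p q : nat -> M) : Prop := {
  rel_pC : forall i j, i < m -> j.+1 < i -> p i * p j = p j * p i;
  rel_pp : forall i, i < m -> p i * p i = p i;
  rel_ppp1 : forall i, i.+1 < m -> p i * p i.+1 * p i = p i * p i.+1;
  rel_ppp2 : forall i, i.+1 < m -> p i.+1 * p i * p i.+1 = p i * p i.+1;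
  rel_pqC : forall i j, i < m -> j < m -> (j < i) || (i.+1 < j) ->
    p i * q j = q j * p i;
  rel_pq : forall i, i < m -> p i * q i = p i;
  rel_pqS : forall i, i.+1 < m -> p i * q i.+1 = q i.+1
}.

Lemma eq_zigzag (M : monoidType) m (p p' q q' : nat -> M) :
  (forall j, j < m -> p j = p' j) -> (forall j, j < m -> q j = q' j) ->
  zigzag_rels m p q -> zigzag_rels m p' q'.
Proof.
move=> pE qE [h1 h2 h3 h4 h5 h6 h7]; split.
- by move=> i j im ji; rewrite -(pE i) -1?(pE j) 1?h1 //; lia.
- by move=> i im; rewrite -pE ?h2.
- by move=> i im; rewrite -(pE i) -?(pE i.+1) ?h3 //; lia.
- by move=> i im; rewrite -(pE i) -?(pE i.+1) ?h4 //; lia.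
- by move=> i j im jm ij; rewrite -pE -1?qE 1?h5.
- by move=> i im; rewrite -pE -?qE ?h6.
- by move=> i im; rewrite -pE -?qE ?h7 //; lia.
Qed.

Definition rev_gen (M : Type) (m : nat) (q : nat -> M) i := q (m.-1 - i).
(** Conjugate of f by the reflection of {0, ..., m}. *)
Definition rev_fun (m : nat) (f : nat -> nat) x := m - f (m - x).
(** The functions denoted by p^i and q^i. *)
Definition lower i x := if x == i.+1 then i else x.
Definition raise i x := if x == i then i.+1 else x.

Lemma lowerP i x : x = i.+1 /\ lower i x = i \/ x <> i.+1 /\ lower i x = x.
Proof. by rewrite /lower; case: eqP; [left | right]. Qed.

Lemma raiseP i x : x = i /\ raise i x = i.+1 \/ x <> i /\ raise i x = x.
Proof. by rewrite /raise; case: eqP => [->|]; [left | right]. Qed.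

(** * Blocks and the decreasing half of the normal form *)

Section Words.
Variable M : monoidType.
Implicit Types (p q : nat -> M) (f g : nat -> nat).

Definition run p b d : M := \prod_(b <= j < d) p j.

Fixpoint desc p f k : M :=
  if k is k'.+1 then run p (f k') k' * desc p f k' else 1.

Lemma run_geq p b d : d <= b -> run p b d = 1.
Proof. by move=> db; rewrite /run big_geq. Qed.

Lemma runS p b d : b <= d -> run p b d.+1 = run p b d * p d.
Proof. by move=> bd; rewrite /run big_nat_recr. Qed.

Lemma commute_run p b d x :
  (forall j, b <= j < d -> commute x (p j)) -> commute x (run p b d).
Proof. by move=> xp; rewrite /run big_nat; apply: commute_prod. Qed.

Lemma commute_desc p f k x :
  (forall y j, y < k -> f y <= j < y -> commute x (p j)) ->
  commute x (desc p f k).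
Proof.
elim: k => [|k IHk] xp /=; first exact: commute1.
apply: commuteM; first by apply: commute_run => j; apply: xp.
by apply: IHk => y j yk; apply: xp; lia.
Qed.

(** Only values below the diagonal matter: a block with [x <= f x] is empty. *)
Lemma eq_desc p q f g k :
  (forall j, j.+1 < k -> p j = q j) ->
  (forall x, x < k -> minn (f x) x = minn (g x) x) ->
  desc p f k = desc q g k.
Proof.
elim: k => [//|k IHk] pq fg /=; congr (_ * _); last first.
  by apply: IHk => [j jk|x xk]; [apply: pq | apply: fg]; lia.
have fgk := fg k (leqnn _).
have [kf|fk] := leqP k (f k); first by rewrite !run_geq //; lia.
have -> : g k = f k by lia.
by rewrite /run; apply: eq_big_nat => j jk; apply: pq; lia.
Qed.

Lemma desc_id p f k : (forall x, x < k -> x <= f x) -> desc p f k = 1.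
Proof.
by elim: k => //= k IHk kf; rewrite run_geq ?kf // mul1g IHk // => x xk; apply: kf; lia.
Qed.

Section Absorption.
Variables (m : nat) (p q : nat -> M).
Hypothesis R : zigzag_rels m p q.


(** The letter commutes leftwards until it meets p^(j+1), where
    p^j p^(j+1) p^j = p^j p^(j+1). *)
Lemma run_mul_gen b d j : d <= m -> b <= j < d -> run p b d * p j = run p b d.
Proof.
elim: d => [|d IHd] dm /andP[bj jd]; first by [].
rewrite runS; last lia.
have [djE|[djE|dj]] : d = j \/ d = j.+1 \/ j.+1 < d by lia.
- by rewrite -mulgA -djE (rel_pp R).
- rewrite djE in dm *; rewrite runS // -!mulgA (mulgA (p j)) (rel_ppp1 R) //; lia.
- by rewrite -mulgA (rel_pC R) // mulgA IHd //; lia.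
Qed.

(** The letter commutes rightwards until it meets p^(j-1), where
    p^j p^(j-1) p^j = p^(j-1) p^j. *)
Lemma gen_mul_run b d j : d <= m -> b <= j < d -> p j * run p b d = run p b d.
Proof.
elim: d => [|d IHd] dm /andP[bj jd]; first by [].
have [jd'|djE] : j < d \/ j = d by lia.
  by rewrite runS ?mulgA ?IHd //; lia.
have [bd|bd] := eqVneq b d.
  by rewrite djE bd runS // run_geq // mul1g (rel_pp R).
have [k dk] : exists k, d = k.+1 by exists d.-1; lia.
rewrite djE dk in dm *; rewrite !runS; try lia.
have /commute_sym pk : commute (p k.+1) (run p b k).
  by apply: commute_run => i ik; rewrite /commute (rel_pC R) //; lia.
rewrite !mulgA -pk -!mulgA (mulgA (p k.+1)) (rel_ppp2 R) //; lia.
Qed.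

Lemma run_mul_run b d a e : d <= m -> b <= a -> e <= d ->
  run p b d * run p a e = run p b d.
Proof.
move=> dm ba; elim: e => [|e IHe] ed; first by rewrite (run_geq p (leq0n a)) mulg1.
have [ea|ae] := leqP e.+1 a; first by rewrite (run_geq p ea) mulg1.
by rewrite (@runS p a) // mulgA IHe ?run_mul_gen //; lia.
Qed.

Lemma run_mul_run_l b d a e : d <= m -> b <= a -> e <= d ->
  run p a e * run p b d = run p b d.
Proof.
move=> dm ba; elim: e => [|e IHe] ed; first by rewrite (run_geq p (leq0n a)) mul1g.
have [ea|ae] := leqP e.+1 a; first by rewrite (run_geq p ea) mul1g.
by rewrite (@runS p a) // -mulgA gen_mul_run ?IHe //; lia.
Qed.

(** p^(i-1) q^i = q^i: moving q^i to the left of a block costs its last letter. *)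
Lemma run_raise b i : i < m -> run p b i * q i = q i * run p b i.-1.
Proof.
move=> im; have [ib|bi] := leqP i b; first by rewrite !run_geq ?mulg1 ?mul1g //; lia.
case: i bi im => [//|i] bi im.
rewrite runS // -mulgA (rel_pqS R) //.
apply/commute_sym/commute_run => j jk.
by rewrite /commute (rel_pqC R) //; lia.
Qed.

Section Monotone.
Variable f : nat -> nat.
Hypothesis f_mono : {homo f : x y / x <= y}.

(** The blocks below i commute with p^i, which then lengthens block i to
    [run p (f i) i.+1]; this swallows block i + 1, and splitting off a copy of
    the old block i gives the blocks of the new function. *)
Lemma desc_lower i k : i < m -> f i <= i -> i.+1 < k -> k <= m.+1 ->
  desc p f k * p i = desc p (f \o lower i) k.
Proof.
move=> im fi; elim: k => [//|k IHk] ik km.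
have [ki|ki] := ltnP i.+1 k.
  by rewrite /= -mulgA IHk /lower ?ifN //; lia.
have {ki ik IHk}kE : k = i.+1 by lia.
rewrite kE /=.
have dp : commute (p i) (desc p f i).
  by apply: commute_desc => y j yi yj; rewrite /commute (rel_pC R) //; lia.
have -> : desc p (f \o lower i) i = desc p f i.
  by apply: eq_desc => // x xi; rewrite /lower /= ifN //; lia.
have -> : lower i i.+1 = i by rewrite /lower eqxx.
have -> : lower i i = i by rewrite /lower ifN //; lia.
rewrite -!mulgA -dp (mulgA (run p (f i) i)) -runS // mulgA.
have fii := f_mono (leqnSn i).
rewrite (mulgA (run p (f i) i.+1)) run_mul_run_l ?run_mul_run //; lia.
Qed.

Lemma commute_desc_raise i k : i < m -> k <= i -> commute (q i) (desc p f k).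
Proof.
move=> im ki; apply: commute_desc => y j yk yj.
by rewrite /commute (rel_pqC R) //; lia.
Qed.

(** After [run_raise], what remains of block i has lost the letter p^(i-1), and
    so it is swallowed by block i - 1, which starts no later. *)
Lemma desc_raise_at i : i < m -> desc p f i.+1 * q i = q i * desc p f i.
Proof.
move=> im /=.
rewrite -mulgA -(@commute_desc_raise i i) // mulgA run_raise // -mulgA.
congr (_ * _); case: i im => [|i] im; first by rewrite /= run_geq // mul1g.
by rewrite /= mulgA run_mul_run_l //; [lia | apply: f_mono].
Qed.

(** The case where i is moved to a value on or below the diagonal: block i + 1
    ends in p^i, which absorbs q^i. *)
Lemma desc_raise_low i k : i < m -> f i.+1 <= i -> i.+1 < k ->
  desc p f k * q i = desc p (f \o raise i) k.
Proof.
move=> im fi; elim: k => [//|k IHk] ik.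
have [ki|ki] := ltnP i.+1 k.
  by rewrite /= -mulgA IHk /raise ?ifN //; lia.
have {ki ik IHk}-> : k = i.+1 by lia.
have desc_eq : desc p (f \o raise i) i = desc p f i.
  by apply: eq_desc => // x xi; rewrite /raise /= ifN //; lia.
have r1 : raise i i.+1 = i.+1 by rewrite /raise ifN //; lia.
have r2 : raise i i = i.+1 by rewrite /raise eqxx.
rewrite [LHS]/= -mulgA -[_ * desc p f i]/(desc p f i.+1) desc_raise_at //.
rewrite [RHS]/= r1 r2 desc_eq !mulgA; congr (_ * _).
by rewrite run_mul_run // runS // -mulgA (rel_pq R).
Qed.

(** The case where i is moved to a value above the diagonal: block i disappears
    and q^i is passed on to the other half of the normal form. *)
Lemma desc_raise_high i k : i < m -> i < f i.+1 -> i < k -> k <= m.+1 ->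
  desc p f k * q i = q i * desc p (f \o raise i) k.
Proof.
move=> im fi; elim: k => [//|k IHk] ik km.
have [ki|ki] := ltnP i k.
  rewrite /= -mulgA IHk //; last lia.
  rewrite !mulgA /raise ifN; last lia.
  congr (_ * _); apply/commute_sym/commute_run => j /andP[fj jk].
  have fk : f i.+1 <= f k by apply: f_mono.
  by rewrite /commute (rel_pqC R) //; lia.
have {ki ik IHk}-> : k = i by lia.
have ri : raise i i = i.+1 by rewrite /raise eqxx.
rewrite desc_raise_at //= ri (run_geq _ (ltnW fi)) mul1g; congr (_ * _).
by apply: eq_desc => // x xi /=; rewrite /raise ifN //; lia.
Qed.

End Monotone.
End Absorption.

(** * Normal forms and right multiplication *)

Lemma rev_fun_mono m f : {homo f : x y / x <= y} ->
  {homo rev_fun m f : x y / x <= y}.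
Proof. by move=> fM x y xy; apply/leq_sub2l/fM; lia. Qed.

(** The left factor is f+: reflecting turns the values above the diagonal into
    values below it. *)
Definition nf m p q f : M :=
  desc (rev_gen m q) (rev_fun m f) m.+1 * desc p f m.+1.

Lemma eq_nf m p q f g : (forall x, x <= m -> f x = g x) ->
  nf m p q f = nf m p q g.
Proof.
move=> fg; congr (_ * _); apply: eq_desc => // x xm; last by rewrite fg.
by rewrite /rev_fun fg //; lia.
Qed.

Lemma nf_id m p q : nf m p q id = 1.
Proof. by rewrite /nf !desc_id ?mulg1 // => x xm; rewrite /rev_fun; lia. Qed.

(** A letter of block x of f- lies in [f x, x - 1] and a letter of block y of f+
    in [y, f y - 1]; monotonicity keeps these ranges disjoint and non-adjacent
    in the way that makes the letters commute. *)
Lemma commute_desc_rev m p q f : zigzag_rels m p q ->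
  {homo f : x y / x <= y} ->
  commute (desc (rev_gen m q) (rev_fun m f) m.+1) (desc p f m.+1).
Proof.
move=> R fM; apply: commute_desc => x j xm jx; apply/commute_sym.
apply: commute_desc => y k ym; rewrite /rev_fun => ky.
rewrite /commute /rev_gen (rel_pqC R) //; try lia.
have [xy|yx|xy] := ltngtP x (m - y); first by lia.
  by have := fM _ _ (ltnW yx); lia.
by rewrite -xy in ky; lia.
Qed.

Section RightMultiplication.
Variables (m : nat) (p q : nat -> M).
Hypotheses (R : zigzag_rels m p q)
           (R' : zigzag_rels m (rev_gen m q) (rev_gen m p)).

(** Reflecting exchanges the two halves, and the halves commute. *)
Lemma nf_rev f : {homo f : x y / x <= y} ->
  nf m (rev_gen m q) (rev_gen m p) (rev_fun m f) = nf m p q f.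
Proof.
move=> fM; rewrite [RHS](commute_desc_rev R fM); congr (_ * _).
apply: eq_desc => [j jm | x xm]; first by rewrite /rev_gen; congr p; lia.
by rewrite /rev_fun; have -> : m - (m - x) = x; lia.
Qed.

Lemma nf_raise f i : {homo f : x y / x <= y} -> i < m ->
  nf m p q f * q i = nf m p q (f \o raise i).
Proof.
move=> fM im; have [fi|fi] := leqP (f i.+1) i.
  rewrite /nf -mulgA (desc_raise_low R) //.
  congr (_ * _); apply: eq_desc => // x xm; rewrite /rev_fun /= /raise.
  by case: eqP => // xE; rewrite xE; have := fM _ _ (leqnSn i); lia.
rewrite /nf -mulgA (desc_raise_high R fM im fi (leqW im) (leqnn _)) mulgA; congr (_ * _).
have -> : q i = rev_gen m q (m.-1 - i) by rewrite /rev_gen; congr q; lia.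
rewrite (desc_lower R') //; first last.
- lia.
- by rewrite /rev_fun; have -> : m - (m.-1 - i) = i.+1; lia.
- lia.
- exact: rev_fun_mono.
apply: eq_desc => // x xm; congr (minn _ _); rewrite /rev_fun /= /lower /raise.
by case: eqP => [xE|xE]; case: eqP => [xE'|xE'] //; try lia; congr (_ - f _); lia.
Qed.
End RightMultiplication.

(** The mirror image of [nf_raise]. *)
Lemma nf_lower m p q f i : zigzag_rels m p q ->
  zigzag_rels m (rev_gen m q) (rev_gen m p) ->
  {homo f : x y / x <= y} -> i < m ->
  nf m p q f * p i = nf m p q (f \o lower i).
Proof.
move=> R R' fM im.
have lM : {homo lower i : x y / x <= y}.
  by move=> x y xy; rewrite /lower; do 2!case: eqP => ?; lia.
rewrite -!(nf_rev R) //; last by move=> x y /lM/fM.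
have -> : p i = rev_gen m p (m.-1 - i) by rewrite /rev_gen; congr p; lia.
rewrite (nf_raise R') //; first last.
- lia.
- exact: rev_fun_mono.
- by rewrite /rev_gen; apply: eq_zigzag R => j jm; congr (_ _); lia.
apply: eq_nf => x xm; rewrite /rev_fun /= /lower /raise.
by case: eqP => [xE|xE]; case: eqP => [xE'|xE'] //; try lia; congr (_ - f _); lia.
Qed.

(** * Evaluation of normal forms *)

(** T stands for a homomorphism to functions on {0, ..., m}, represented by
    functions on nat that are only relevant up to m; this covers both the
    evaluation of words and its conjugate by the reflection. *)
Section Action.
Variables (m : nat) (p : nat -> M) (T : M -> nat -> nat).
Hypotheses (T1 : forall x, x <= m -> T 1 x = x)
  (TM : forall a b x, x <= m -> T (a * b) x = T a (T b x))
  (Tp : forall i x, i < m -> x <= m -> T (p i) x = lower i x).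

Lemma run_action b d x : b <= d -> d <= m -> x <= m ->
  T (run p b d) x = if b <= x <= d then b else x.
Proof.
elim: d x => [|d IHd] x bd dm xm.
  by rewrite run_geq // T1 //; case: ifP => //; lia.
have [bd'|{}bd] : b = d.+1 \/ b <= d by lia.
  by rewrite run_geq -?bd' // T1 //; case: ifP => //; lia.
rewrite runS // TM // Tp // IHd /lower //; try lia; case: eqP => xE; try lia.
all: by do 2!case: ifP => //; lia.
Qed.

Lemma desc_action f k x : {homo f : x y / x <= y} -> k <= m.+1 -> x <= m ->
  T (desc p f k) x = if x < k then minn (f x) x else x.
Proof.
move=> fM; elim: k x => [|k IHk] x km xm /=; first exact: T1.
rewrite TM // IHk //; last lia.
have fxk : x <= k -> f x <= f k by apply: fM.
have fkx : k <= x -> f k <= f x by apply: fM.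
have [kf|fk] := leqP k (f k).
  rewrite run_geq // T1; last by case: ifP; lia.
  have [xk|xk|xE] := ltngtP x k; [rewrite leqW| |] => //.
    by rewrite ifN //; lia.
  by rewrite xE ltnSn; lia.
rewrite run_action; try (case: ifP; lia); try lia.
by have [xk|kx] := ltnP x k; do 2!case: ifP => ?; lia.
Qed.
End Action.

(** The identity f = f+ o f- applied to the two halves of the normal form. *)
Lemma nf_action m p q (T : M -> nat -> nat) f :
  (forall x, T 1 x = x) ->
  (forall a b x, T (a * b) x = T a (T b x)) ->
  (forall a x, x <= m -> T a x <= m) ->
  (forall i x, i < m -> T (p i) x = lower i x) ->
  (forall i x, i < m -> T (q i) x = raise i x) ->
  {homo f : x y / x <= y} -> (forall x, x <= m -> f x <= m) ->
  forall x, x <= m -> T (nf m p q f) x = f x.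
Proof.
move=> T1 TM Tm Tp Tq fM fm x xm.
have low y : y <= m -> T (desc p f m.+1) y = minn (f y) y.
  move=> ym; rewrite (@desc_action m) ?ltnS ?ym //.
  by move=> i z im _; apply: Tp.
have high y : y <= m ->
    T (desc (rev_gen m q) (rev_fun m f) m.+1) y = maxn (f y) y.
  move=> ym.
  have act : rev_fun m (T (desc (rev_gen m q) (rev_fun m f) m.+1)) (m - y)
             = minn (rev_fun m f (m - y)) (m - y).
    rewrite (@desc_action m (rev_gen m q) (fun a => rev_fun m (T a))).
    - by rewrite ltnS leq_subr.
    - by move=> z zm; rewrite /rev_fun T1; lia.
    - move=> a b z zm; rewrite /rev_fun TM; congr (m - T a _).
      by have := Tm b (m - z) (leq_subr _ _); lia.
    - move=> i z im zm; rewrite /rev_fun /rev_gen Tq /lower /raise; last lia.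
      by case: eqP => ?; case: eqP => ?; lia.
    - exact: rev_fun_mono.
    - by [].
    - exact: leq_subr.
  have ty := Tm (desc (rev_gen m q) (rev_fun m f) m.+1) y ym.
  by move: act (fm y ym) ty; rewrite {1 3}/rev_fun; have -> : m - (m - y) = y; lia.
rewrite /nf TM low // high; last lia.
have [fx|xf] := leqP (f x) x; last by lia.
by have := fM _ _ fx; lia.
Qed.
End Words.

(** * The presented monoid and the endomorphisms in the simplicial category *)

Section Omonoid.
Variable n : nat.
Local Notation m := n.-1.

Definition genp i : Omonoid n := oapp (@Op n) 1 (insub i).
Definition genq i : Omonoid n := oapp (@Oq n) 1 (insub i).

Definition cls (u : mterm (Ogen n)) : Omonoid n := pclass (@Orel n) u.

Lemma clsM u v : cls (MMul u v) = cls u * cls v.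
Proof. exact: pclassM. Qed.

Lemma cls_rel u v : Orel u v -> cls u = cls v.
Proof. by move=> uv; apply/eqP/pclassP/meq_rel. Qed.

Lemma genpE (i : 'I_m) : genp i = cls (MGen (Pgen i)).
Proof. by rewrite /genp valK. Qed.

Lemma genqE (i : 'I_m) : genq i = cls (MGen (Qgen i)).
Proof. by rewrite /genq valK. Qed.

Lemma ord_exists i : i < m -> exists j : 'I_m, i = j.
Proof. by move=> im; exists (Ordinal im). Qed.

Lemma gen_zigzag : zigzag_rels m genp genq.
Proof.
split.
- move=> i j im ji; have /ord_exists[b jb] : j < m by lia.
  have [a ia] := ord_exists im; rewrite ia jb !genpE -!clsM.
  by apply/cls_rel/Orel_pC; rewrite -ia -jb.
- move=> _ /ord_exists[a ->]; rewrite !genpE -!clsM.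
  exact/cls_rel/Orel_pp.
- move=> i /[dup] im /ord_exists[b jb]; have /ord_exists[a ia] : i < m by lia.
  rewrite jb ia !genpE -!clsM (cls_rel (Orel_ppp1 _)) -?ia ?jb //.
  by apply/cls_rel/Orel_ppp2; rewrite -ia -jb.
- move=> i /[dup] im /ord_exists[b jb]; have /ord_exists[a ia] : i < m by lia.
  by rewrite jb ia !genpE -!clsM; apply/cls_rel/Orel_ppp2; rewrite -ia -jb.
- move=> _ _ /ord_exists[a ->] /ord_exists[b ->] ab.
  by rewrite !genpE !genqE -!clsM; apply/cls_rel/Orel_pqC.
- move=> _ /ord_exists[a ->]; rewrite !genpE !genqE -!clsM.
  exact/cls_rel/Orel_pq.
- move=> i /[dup] im /ord_exists[b jb]; have /ord_exists[a ia] : i < m by lia.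
  by rewrite jb ia !genpE !genqE -!clsM; apply/cls_rel/Orel_pqS; rewrite -ia -jb.
Qed.

Lemma gen_zigzag_rev : zigzag_rels m (rev_gen m genq) (rev_gen m genp).
Proof.
have rev_succ i : i.+1 < m -> exists2 a : 'I_m, m.-1 - i.+1 = a &
    exists2 b : 'I_m, m.-1 - i = b & b = a.+1 :> nat.
  move=> im; have /ord_exists[a ia] : m.-1 - i.+1 < m by lia.
  have /ord_exists[b ib] : m.-1 - i < m by lia.
  by exists a => //; exists b => //; lia.
have rev_exists i : i < m -> exists a : 'I_m, m.-1 - i = a.
  by move=> im; apply: ord_exists; lia.
split; rewrite /rev_gen.
- move=> i j im ji; have /rev_exists[b jb] : j < m by lia.
  have [a ia] := rev_exists i im; rewrite ia jb !genqE -!clsM.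
  by apply/esym/cls_rel/Orel_qC; lia.
- move=> _ /rev_exists[a ->]; rewrite !genqE -!clsM.
  exact/cls_rel/Orel_qq.
- move=> _ /rev_succ[a -> [b -> ab]]; rewrite !genqE -!clsM.
  exact/cls_rel/Orel_qqq2.
- move=> _ /rev_succ[a -> [b -> ab]]; rewrite !genqE -!clsM.
  by rewrite (cls_rel (Orel_qqq1 ab)); apply/cls_rel/Orel_qqq2.
- move=> i j /[dup] im /rev_exists[a ia] /[dup] jm /rev_exists[b jb] ij.
  by rewrite ia jb !genpE !genqE -!clsM; apply/esym/cls_rel/Orel_pqC; lia.
- move=> _ /rev_exists[a ->]; rewrite !genpE !genqE -!clsM.
  exact/cls_rel/Orel_qp.
- move=> _ /rev_succ[a -> [b -> ab]]; rewrite !genpE !genqE -!clsM.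
  exact/cls_rel/Orel_qSp.
Qed.

(** Extending by the identity outside the ordinal makes [app] a homomorphism on
    all of nat and keeps the extended functions monotone, also for n = 0. *)
Definition app (f : DeltaEnd n) x : nat :=
  oapp (fun y : 'I_n => f y : nat) x (insub x).

Lemma app_ord f (y : 'I_n) : app f y = f y.
Proof. by rewrite /app valK. Qed.

Lemma app_out f x : n <= x -> app f x = x.
Proof. by move=> nx; rewrite /app insubN // -leqNgt. Qed.

Lemma app_inj f g : app f =1 app g -> f = g.
Proof.
move=> fg; apply/val_inj/ffunP => y; apply/val_inj.
by have := fg y; rewrite !app_ord.
Qed.

Lemma app1 x : app 1 x = x.
Proof.
have [xn|nx] := ltnP x n; last exact: app_out.
by rewrite (app_ord _ (Ordinal xn)) ffunE.
Qed.

Lemma appM f g x : app (f * g) x = app f (app g x).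
Proof.
have [xn|nx] := ltnP x n; last by rewrite !(app_out _ nx).
by rewrite !(app_ord _ (Ordinal xn)) app_ord ffunE.
Qed.

Lemma app_lt f x : x < n -> app f x < n.
Proof. by move=> xn; rewrite (app_ord _ (Ordinal xn)). Qed.

Lemma app_mono f : {homo app f : x y / x <= y}.
Proof.
move=> x y xy; have [yn|ny] := ltnP y n.
  rewrite (app_ord _ (Ordinal yn)) (app_ord _ (Ordinal (leq_ltn_trans xy yn))).
  exact: (order_preservingP _ (Delta_homo f)).
rewrite (app_out f ny); have [xn|nx] := ltnP x n; last by rewrite app_out.
by apply: ltnW; apply: leq_trans ny; apply: app_lt.
Qed.

Lemma app_p (i : 'I_m) : app (sigma_p i) =1 lower i.
Proof.
move=> x; rewrite /lower; have [xn|nx] := ltnP x n.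
  by rewrite (app_ord _ (Ordinal xn)) ffunE -val_eqE /=; case: ifP.
by rewrite app_out // ifN //; have := ltn_ord i; lia.
Qed.

Lemma app_q (i : 'I_m) : app (sigma_q i) =1 raise i.
Proof.
move=> x; rewrite /raise; have [xn|nx] := ltnP x n.
  by rewrite (app_ord _ (Ordinal xn)) ffunE -val_eqE /=; case: ifP.
by rewrite app_out // ifN //; have := ltn_ord i; lia.
Qed.

Fixpoint eval (u : mterm (Ogen n)) : DeltaEnd n :=
  match u with
  | MGen (Pgen i) => sigma_p i
  | MGen (Qgen i) => sigma_q i
  | MOne => 1
  | MMul u v => eval u * eval v
  end.

Lemma eval_rel u v : Orel u v -> eval u = eval v.
Proof.
case=> [i j ij|i|i j ij|i j ij|i j ij|i|i j ij|i j ij|i j ij|i|i j ij|i|i j ij];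
  apply: app_inj => x; rewrite /= !appM ?app_p ?app_q ?app_p ?app_q.
all: repeat match goal with
  | |- context [lower ?a ?b] =>
      move: (lower a b) (lowerP a b) => ?
  | |- context [raise ?a ?b] =>
      move: (raise a b) (raiseP a b) => ?
  end; lia.
Qed.

Lemma eval_meq u v : meq (@Orel n) u v -> eval u = eval v.
Proof.
elim=> //= {u v}.
- by move=> u v w _ -> _ ->.
- by move=> u u' v v' _ -> _ ->.
- by move=> u v w; rewrite mulgA.
- by move=> u; rewrite mul1g.
- by move=> u; rewrite mulg1.
- exact: eval_rel.
Qed.

Definition sigma (x : Omonoid n) : DeltaEnd n := eval (repr x).

Lemma sigma_cls u : sigma (cls u) = eval u.
Proof. exact/eval_meq/repr_pclass. Qed.

Lemma cls_repr (x : Omonoid n) : cls (repr x) = x.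
Proof. exact: pclass_repr. Qed.

Lemma sigma_monoid_morphism : monoid_morphism sigma.
Proof.
split; first exact: (sigma_cls MOne).
by move=> x y; rewrite -[x]cls_repr -[y]cls_repr -clsM !sigma_cls.
Qed.

HB.instance Definition _ :=
  isUMagmaMorphism.Build (Omonoid n) (DeltaEnd n) sigma sigma_monoid_morphism.

Definition word (f : DeltaEnd n) : Omonoid n := nf m genp genq (app f).

(** With f = 1 this says that a word is determined by the function it denotes. *)
Lemma word_mul_cls f u : word f * cls u = word (f * eval u).
Proof.
elim: u f => [[i|i]||u IHu v IHv] f /=.
- rewrite -genpE /word (nf_lower gen_zigzag gen_zigzag_rev) //; last exact: app_mono.
  by apply: eq_nf => x _; rewrite appM app_p.
- rewrite -genqE /word (nf_raise gen_zigzag gen_zigzag_rev) //; last exact: app_mono.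
  by apply: eq_nf => x _; rewrite appM app_q.
- rewrite [f * 1]mulg1; exact: mulg1.
- by rewrite clsM mulgA IHu IHv mulgA.
Qed.

Lemma sigmaK : cancel sigma word.
Proof.
move=> x; rewrite -[x]cls_repr sigma_cls -[eval _]mul1g -word_mul_cls.
have -> : word 1 = 1; last by rewrite mul1g.
by rewrite -(nf_id m genp genq); apply: eq_nf => x' _; apply: app1.
Qed.

Lemma wordK : cancel word sigma.
Proof.
move=> f; apply: app_inj => x.
have [xn|nx] := ltnP x n; last by rewrite !app_out.
apply: (nf_action (m := m) (T := fun a => app (sigma a))); last lia.
- by move=> y; rewrite gmulf1 app1.
- by move=> a b y; rewrite gmulfM appM.
- by move=> a y ym; have := @app_lt (sigma a) y; lia.
- by move=> _ y /ord_exists[i ->]; rewrite genpE sigma_cls app_p.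
- by move=> _ y /ord_exists[i ->]; rewrite genqE sigma_cls app_q.
- exact: app_mono.
- by move=> y ym; have := @app_lt f y; lia.
Qed.
End Omonoid.

Theorem mainTheorem1 (n : nat) :
  exists sigma : UMagmaMorphism.type (Omonoid n) (DeltaEnd n),
    [/\ bijective sigma,
        forall i : 'I_n.-1, sigma (Op i) = sigma_p i
      & forall i : 'I_n.-1, sigma (Oq i) = sigma_q i].
Proof.
exists (sigma (n := n)); split; first exact: Bijective (@sigmaK n) (@wordK n).
- by move=> i; apply: sigma_cls.
- by move=> i; apply: sigma_cls.
Qed.
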